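(* For every $\varepsilon>0$ there exists $f_0$ such that the following holds. Let $\Delta$ be a positive integer and $f$ a real with $f_0\le f\le\Delta^2+1$, and let $G$ be a graph of maximum degree $\Delta$ in which the neighbourhood of every vertex spans at most $\Delta^2/f$ edges. Then $\chi(G)\le(1+\varepsilon)\Delta/\log\sqrt f$. (That is, $\chi(G)\le(1+o(1))\Delta/\log\sqrt f$ as $f\to\infty$.)
   Context: All graphs are finite and simple; $\log$ is the natural logarithm; $\chi(G)$ is the chromatic number. The neighbourhood $N(u)$ spans $|E(G[N(u)])|$ edges. *)

(* Defs.v *)
From mathcomp Require Import all_boot.
From Stdlib Require Import Reals.
Set Implicit Arguments. Unset Strict Implicit. Unset Printing Implicit Defensive.

(* A finite simple graph: vertex type T : finType, adjacency e : rel T,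
   assumed symmetric and irreflexive in the theorem. *)

Definition nbhd (T : finType) (e : rel T) (v : T) : {set T} := [set u | e v u].

Definition deg (T : finType) (e : rel T) (v : T) : nat := #|nbhd e v|.

(* Maximum degree of the graph (0 for the empty graph) *)
Definition maxdeg (T : finType) (e : rel T) : nat := \max_(v : T) deg e v.

Definition nbhd_edges (T : finType) (e : rel T) (v : T) : nat :=
  #|[set S : {set T} | [&& #|S| == 2, S \subset nbhd e v &
       [forall x in S, forall y in S, (x != y) ==> e x y]]]|.

Definition colorable (T : finType) (e : rel T) (k : nat) : bool :=
  [exists c : {ffun T -> 'I_k}, [forall x, forall y, e x y ==> (c x != c y)]].

Lemma colorable_card (T : finType) (e : rel T) :
  irreflexive e -> colorable e #|T|.
Proof.
move=> irr; apply/existsP; exists [ffun x => enum_rank x].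
apply/forallP=> x; apply/forallP=> y; apply/implyP=> exy.
rewrite !ffunE; apply/negP=> /eqP /enum_rank_inj exy'.
by move: exy; rewrite exy' irr.
Qed.

Definition chi (T : finType) (e : rel T) (irr : irreflexive e) : nat :=
  ex_minn (ex_intro (fun k => colorable e k) #|T| (colorable_card irr)).

(* Main.v *)
Require Import Defs.
From Stdlib Require Import Reals Lra.
From mathcomp Require Import all_boot order ssralg ssrnum.
Set Implicit Arguments. Unset Strict Implicit. Unset Printing Implicit Defensive.

(* Rosenfeld's counting method, as adapted by Hurley and Pirot to locally sparse
   graphs.  Let C(S) be the number of proper q-colorings of G[S].  By induction on
   |S|, C(S + v) >= ell C(S) for every v outside S, that is, in a uniformly random
   coloring of G[S] the expected number of colors available at v is at least ell.
   By induction, a given u in S has fewer than t available colors with probability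
   at most t / ell, so few neighbors of v have such short lists; few neighbors of v
   have degree more than D = Delta / sqrt f inside N(v).  Fix the coloring of
   everything but the remaining (good) neighbors of v.  When these are recolored,
   each misses a given color y with probability at least 1 - 1 / (|L u| - D) if y is
   in its list L u, whatever the earlier ones do, and convexity of exp gives about
   q exp (- Delta / q) expected colors missing from N(v). *)

(** * Partial proper colorings and recoloring of one vertex *)

Section PartialColorings.
Variables (T : finType) (e : rel T) (sym : symmetric e) (irr : irreflexive e).
Variable q : nat.

Definition partial_coloring := {ffun T -> option 'I_q}.
Implicit Types (c r : partial_coloring) (S N : {set T}) (u v w : T) (y z : 'I_q).

(** [None] marks an uncolored vertex. A colored vertex always differs from an uncolored one, so only
    edges inside [S] are constrained. *)
Definition proper_on S : {set partial_coloring} :=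
  [set c : partial_coloring | [forall x, (c x != None) == (x \in S)] &&
     [forall x, forall w, e x w && (c x != None) ==> (c x != c w)]].

Lemma proper_onP S c :
  reflect ((forall x, (c x != None) = (x \in S)) /\
           (forall x w, e x w -> c x != None -> c x != c w))
          (c \in proper_on S).
Proof.
rewrite inE; apply: (iffP andP) => [[/forallP H1 /forallP H2]|[H1 H2]]; split.
- by move=> x; apply: eqP (H1 x).
- by move=> x w exy cx; move/forallP: (H2 x) => /(_ w); rewrite exy cx.
- by apply/forallP => x; rewrite H1.
- apply/forallP => x; apply/forallP => w; apply/implyP => /andP[exy cx].
  exact: H2.
Qed.

(** The color of [v] itself is ignored, so recoloring [v] leaves the set unchanged and it also makes
    sense for a colored [v]. *)
Definition avail c v : {set 'I_q} :=
  [set y | [forall w, e v w ==> (c w != Some y)]].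

Lemma availP c v y :
  reflect (forall w, e v w -> c w != Some y) (y \in avail c v).
Proof.
rewrite inE; apply: (iffP forallP) => H w; last exact/implyP/H.
exact/implyP/H.
Qed.

Definition recolor c v (a : option 'I_q) : partial_coloring :=
  [ffun w => if w == v then a else c w].

Lemma recolorK c v a b : c v = b -> recolor (recolor c v a) v b = c.
Proof. by move=> cv; apply/ffunP=> w; rewrite !ffunE; case: (w =P v) => // ->. Qed.

Lemma avail_recolor c v a : avail (recolor c v a) v = avail c v.
Proof.
apply/setP=> y; rewrite !inE; apply: eq_forallb => w; rewrite ffunE.
by case: (w =P v) => // ->; rewrite irr.
Qed.

Lemma recolor_proper S c v y :
  c \in proper_on S -> y \in avail c v -> recolor c v (Some y) \in proper_on (v |: S).
Proof.
move=> /proper_onP[dom pr] /availP av; apply/proper_onP; split=> [x|x w exw].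
  by rewrite !inE ffunE; case: (x =P v) => // _; rewrite dom.
rewrite !ffunE; case: (x =P v) => [xv _|xv cx].
  case: (w =P v) => [wv|_]; first by rewrite xv wv irr in exw.
  by rewrite eq_sym av // -xv.
case: (w =P v) => [wv|_]; last exact: pr.
by apply: av; rewrite -wv sym.
Qed.

Lemma erase_proper S c v :
  c \in proper_on S -> recolor c v None \in proper_on (S :\ v).
Proof.
move=> /proper_onP[dom pr]; apply/proper_onP; split=> [x|x w exw].
  by rewrite !inE ffunE; case: (x =P v) => // _; rewrite dom.
rewrite !ffunE; case: (x =P v) => // xv cx.
by case: (w =P v) => [wv|_]; [|exact: pr].
Qed.

Lemma own_color_avail S c v y :
  c \in proper_on S -> c v = Some y -> y \in avail c v.
Proof.
move=> /proper_onP[dom pr] cv; apply/availP => w evw.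
by rewrite -cv eq_sym pr // cv.
Qed.

(* The pair (c, y) is recovered from recolor c v (Some y), because c v = a is known. *)
Lemma sum_avail_le v a (Y X : {set partial_coloring}) :
  (forall c, c \in Y -> c v = a) ->
  (forall c y, c \in Y -> y \in avail c v -> recolor c v (Some y) \in X) ->
  \sum_(c in Y) #|avail c v| <= #|X|.
Proof.
move=> Ya YX.
under eq_bigr do rewrite -sum1_card.
rewrite (pair_big_dep (mem Y) (fun c y => y \in avail c v)) /= sum1dep_card.
set P := [set p | _].
rewrite -(@card_in_imset _ _ (fun p : partial_coloring * 'I_q => recolor p.1 v (Some p.2))).
  apply/subset_leq_card/subsetP => c /imsetP[[c' y]]; rewrite inE /= => /andP[cY yc ->].
  exact: YX.
move=> [c y] [c' y']; rewrite !inE /= => /andP[cY _] /andP[cY' _] E.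
have := congr1 (fun f : partial_coloring => f v) E; rewrite !ffunE eqxx => -[->].
congr pair; rewrite -(recolorK (Some y) (Ya _ cY)) E.
by rewrite recolorK // Ya.
Qed.

Lemma sum_avail_proper S v : v \notin S ->
  \sum_(c in proper_on S) #|avail c v| <= #|proper_on (v |: S)|.
Proof.
move=> vS; apply: (sum_avail_le (a := None)) => [c /proper_onP[dom _]|c y cS yc].
  by apply/eqP; rewrite -[_ == _]negbK dom.
exact: recolor_proper.
Qed.

(** Group the colorings by what remains after erasing [v]. Within a group the available set at [v]
    is common and contains the color of [v], which determines the coloring; so a group meeting the
    event has fewer than [t] members. *)
Lemma card_few_avail S v t : v \in S ->
  #|[set c in proper_on S | #|avail c v| < t]| <= t * #|proper_on (S :\ v)|.
Proof.
move=> vS; rewrite -sum1_card.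
rewrite (partition_big (fun c => recolor c v None) (mem (proper_on (S :\ v)))) /=;
  last first.
  by move=> c; rewrite inE => /andP[cS _]; exact: erase_proper.
rewrite mulnC -sum_nat_const; apply: leq_sum => c' c'S.
rewrite sum1dep_card.
set F := [set _ | _].
have FP c : c \in F -> [/\ c \in proper_on S, #|avail c' v| < t &
    exists2 y, y \in avail c' v & c = recolor c' v (Some y)].
  rewrite inE => /andP[]; rewrite inE => /andP[cS ct] /eqP cc'.
  rewrite -cc' avail_recolor; split=> //.
  case E: (c v) => [y|]; last by move/proper_onP: cS => [/(_ v) + _]; rewrite E vS.
  by exists y; [exact: own_color_avail cS E|rewrite recolorK].
have [->|[c0 c0F]] := set_0Vmem F; first by rewrite cards0.
have [_ lt_t _] := FP _ c0F.
apply: leq_trans (ltnW lt_t).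
rewrite -(card_imset (mem (avail c' v)) (f := Some)); last by move=> ? ? [].
have injF : {in F &, injective (fun c : partial_coloring => c v)}.
  move=> c d /FP[_ _ [y _ ->]] /FP[_ _ [z _ ->]]; by rewrite !ffunE eqxx => -[->].
rewrite -(card_in_imset injF); apply/subset_leq_card/subsetP=> a /imsetP[c /FP[_ _ [y yc ->]] ->].
by rewrite ffunE eqxx imset_f.
Qed.

End PartialColorings.

(** * Double counting of the edges inside a neighborhood *)

(** Handshake in the graph induced on the neighborhood: ordered adjacent pairs are sent to their
    edge, and the pairs over one edge inject into it by their first coordinate. *)
Lemma sum_nbhd_degrees (T : finType) (e : rel T) (v : T) :
  symmetric e -> irreflexive e ->
  (\sum_(u in nbhd e v) #|nbhd e u :&: nbhd e v| <= 2 * nbhd_edges e v)%N.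
Proof.
move=> sym irr; under eq_bigr do rewrite -sum1_card.
rewrite (pair_big_dep (mem (nbhd e v)) (fun u w => w \in nbhd e u :&: nbhd e v)) /=.
rewrite /nbhd_edges; set EE := [set A : {set T} | _].
rewrite (partition_big (fun p : T * T => [set p.1; p.2]) (mem EE)) /=; last first.
  move=> [u w] /=; rewrite !inE => /and3P[uN uw wN].
  have uw' : u != w by apply/eqP => uw'; rewrite uw' irr in uw.
  rewrite cards2 uw' /=; apply/andP; split.
    by apply/subsetP => x /set2P[] ->; rewrite inE.
  apply/forallP => x; apply/implyP => /set2P xuw; apply/forallP => y.
  apply/implyP => /set2P yuw; apply/implyP.
  by case: xuw => ->; case: yuw => -> //; rewrite ?eqxx // sym.
rewrite mulnC -sum_nat_const; apply: leq_sum => A AE.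
have /eqP <- : #|A| == 2 by move: AE; rewrite inE => /and3P[].
rewrite sum1dep_card -(@card_in_imset _ _ fst).
  apply/subset_leq_card/subsetP => _ /imsetP[[u w]] /[!inE] /andP[_ /eqP <-] ->.
  exact: set21.
move=> [u w] [u' w'] /[!inE] /= /andP[/and3P[_ uw _] /eqP E1].
move=> /andP[_ /eqP E2] uu'; rewrite -uu' in E2 *; congr pair.
have : w \in [set u; w'] by rewrite E2 -E1 set22.
by case/set2P => // wu; rewrite wu irr in uw.
Qed.

Lemma card_high_degree (T : finType) (e : rel T) (v : T) (D : nat) :
  symmetric e -> irreflexive e ->
  (#|[set u in nbhd e v | D < #|nbhd e u :&: nbhd e v|]| * D.+1 <= 2 * nbhd_edges e v)%N.
Proof.
move=> sym irr; apply: leq_trans (sum_nbhd_degrees v sym irr).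
rewrite -sum_nat_const [leqRHS](bigID (fun u => D < #|nbhd e u :&: nbhd e v|)) /=.
apply: leq_trans (leq_addr _ _).
rewrite (eq_bigl (fun u => (u \in nbhd e v) && (D < #|nbhd e u :&: nbhd e v|))).
  by apply: leq_sum => u /andP[].
by move=> u; rewrite inE.
Qed.

(** * Classes of colorings that differ only on the good neighbors of a vertex *)

Section Resampling.
Variables (T : finType) (e : rel T) (sym : symmetric e) (irr : irreflexive e).
Variables (q : nat) (S : {set T}) (v : T) (D t : nat).
Local Notation coloring := (partial_coloring T q).
Local Notation N := (nbhd e v).
Implicit Types (c d r : coloring) (u w : T) (y z : 'I_q).

(** The list of [u] used for resampling: it reads only colors outside [N], so it stays fixed while
    [N] is recolored. *)
Definition local_avail c u : {set 'I_q} :=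
  [set y | [forall w, e u w && (w \notin N) ==> (c w != Some y)]].

Lemma local_avail_ext c d : (forall w, w \notin N -> c w = d w) ->
  local_avail c =1 local_avail d.
Proof.
move=> cd u; apply/setP => y; rewrite !inE; apply: eq_forallb => w.
by case: (boolP (w \in N)) => wN; rewrite ?andbF // cd.
Qed.

Lemma avail_sub_local c u : avail e c u \subset local_avail c u.
Proof.
apply/subsetP => y /availP yc; rewrite inE; apply/forallP => w.
by apply/implyP => /andP[euw _]; exact: yc.
Qed.

Lemma card_local_avail c u :
  (#|local_avail c u| <= #|avail e c u| + #|nbhd e u :&: N|)%N.
Proof.
rewrite -(cardsID (avail e c u)) leq_add ?subset_leq_card ?subsetIr //.
rewrite -(@card_imset _ _ (@Some 'I_q)); last by move=> ? ? [].
apply: leq_trans (leq_imset_card c _).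
apply/subset_leq_card/subsetP => _ /imsetP[y yD ->].
move: yD; rewrite !inE negb_forall => /andP[/existsP[w]].
rewrite negb_imply negbK => /andP[euw /eqP cw] /forallP /(_ w).
rewrite euw cw eqxx /= implybF negbK => wN.
by rewrite -cw imset_f // inE wN inE euw.
Qed.

(** Goodness is stated with [local_avail] rather than [avail] so that it depends only on the colors
    outside [N] and is constant on a class. *)
Definition good_nbrs c : {set T} :=
  [set u in N :&: S | (#|nbhd e u :&: N| <= D)%N && (t <= #|local_avail c u|)%N].

Definition bad_nbrs c : {set T} := N :&: S :\: good_nbrs c.

Definition forget_good c : coloring :=
  [ffun w => if w \in good_nbrs c then None else c w].

Lemma good_sub c : good_nbrs c \subset N :&: S.
Proof. by apply/subsetP => u; rewrite inE => /andP[]. Qed.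

Lemma good_nbrs_ext c d : (forall w, w \notin N -> c w = d w) ->
  good_nbrs c = good_nbrs d.
Proof. by move=> cd; apply/setP => u; rewrite !inE (local_avail_ext cd). Qed.

Lemma forget_good_out c w : w \notin N -> forget_good c w = c w.
Proof.
move=> wN; rewrite ffunE; case: ifP => // /(subsetP (good_sub c)).
by rewrite inE (negPf wN).
Qed.

Lemma good_forget c : good_nbrs (forget_good c) = good_nbrs c.
Proof. exact/good_nbrs_ext/forget_good_out. Qed.

Lemma bad_forget c : bad_nbrs (forget_good c) = bad_nbrs c.
Proof. by rewrite /bad_nbrs good_forget. Qed.

Definition coloring_class r : {set coloring} :=
  [set c in proper_on e q S | forget_good c == r].

Lemma classP r c : c \in coloring_class r ->
  [/\ c \in proper_on e q S, good_nbrs c = good_nbrs r,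
      (forall u, local_avail c u = local_avail r u) &
      (forall w, w \notin good_nbrs r -> c w = r w)].
Proof.
rewrite inE => /andP[cS /eqP <-]; rewrite good_forget; split=> //.
  by apply: local_avail_ext => w wN; rewrite forget_good_out.
by move=> w wG; rewrite ffunE (negPf wG).
Qed.

Lemma class_recolor r c u y : c \in coloring_class r -> u \in good_nbrs r ->
  y \in avail e c u -> recolor c u (Some y) \in coloring_class r.
Proof.
move=> cr uG yc; have [cS Gc _ _] := classP cr.
have /setIP[uN uS] := subsetP (good_sub r) _ uG.
have Gd : good_nbrs (recolor c u (Some y)) = good_nbrs r.
  rewrite -Gc; apply: good_nbrs_ext => w wN; rewrite ffunE.
  by case: eqP => // wu; rewrite wu uN in wN.
move: cr; rewrite !inE => /andP[_ /eqP fc].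
have := recolor_proper sym irr cS yc; rewrite (setUidPr _) ?sub1set // inE => -> /=.
rewrite -{1}fc; apply/eqP/ffunP => w; rewrite !ffunE Gd Gc.
by case: ifP => // wG; case: eqP => // wu; rewrite wu uG in wG.
Qed.

(** A coloring of the class agrees with [r] off the good neighbors, so a color that [r] leaves
    available at [v] remains so once the good neighbors avoid it. The rest is an exchange of
    sums. *)
Lemma class_avail_ge r :
  (\sum_(y in avail e r v) #|[set c in coloring_class r |
      all (fun u => c u != Some y) (enum (good_nbrs r))]| <=
   \sum_(c in coloring_class r) #|avail e c v|)%N.
Proof.
under [leqRHS]eq_bigr do rewrite -sum1_card.
rewrite (exchange_big_dep xpredT) //=.
rewrite [leqRHS](bigID (mem (avail e r v))) /= -[leqLHS]addn0 leq_add //.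
apply: leq_sum => y /availP yr; rewrite sum1dep_card.
apply/subset_leq_card/subsetP => c; rewrite inE => /andP[cr /allP yc].
have [_ _ _ cE] := classP cr.
rewrite inE cr; apply/availP => w evw.
have [wG|wG] := boolP (w \in good_nbrs r); last by rewrite cE // yr.
by apply: yc; rewrite mem_enum.
Qed.

(** In [r] the only colored neighbors of [v] are the bad ones, each blocking at most one color. The
    member [c] ensures that [r] is really the trace of a coloring. *)
Lemma card_avail_class r c : c \in coloring_class r ->
  (q <= #|avail e r v| + #|bad_nbrs r|)%N.
Proof.
move=> cr; have [/proper_onP[dom _] _ _ cE] := classP cr.
rewrite -[leqLHS](card_ord q) -(cardsC (avail e r v)) leq_add2l.
rewrite -(@card_imset _ _ (@Some 'I_q)); last by move=> ? ? [].
apply: leq_trans (leq_imset_card r _).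
apply/subset_leq_card/subsetP => _ /imsetP[y yr ->].
move: yr; rewrite !inE negb_forall => /existsP[w].
rewrite negb_imply negbK => /andP[evw /eqP rw].
rewrite -rw imset_f // inE.
have wG : w \notin good_nbrs r.
  apply/negP => wG; move: cr; rewrite inE => /andP[_ /eqP fc].
  by move: wG rw; rewrite -fc good_forget => wG; rewrite ffunE wG.
by rewrite wG !inE evw -dom cE // rw.
Qed.

End Resampling.

(** * Real estimates and the choice of parameters *)

Section Numerics.
Local Open Scope R_scope.

Lemma nat_floor (x : R) : 0 <= x -> exists n : nat, INR n <= x < INR n + 1.
Proof.
move=> x0; have [H1 H2] := archimed x.
have up0 : (0 < up x)%Z by apply: lt_IZR; apply: Rle_lt_trans H1.
exists (Z.to_nat (Z.pred (up x))).
rewrite INR_IZR_INZ Znat.Z2Nat.id; last exact: Zorder.Zlt_0_le_0_pred.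
rewrite /Z.pred plus_IZR; lra.
Qed.

(** This and the cubic bound below suffice: [z] has to beat a multiple of [lam], and [x] a multiple
    of [lam ^ 2]. *)
Lemma exp_ge_square (x : R) : 0 <= x -> x ^ 2 / 4 <= exp x.
Proof.
move=> x0; have -> : x = x / 2 + x / 2 by field.
rewrite exp_plus; have := exp_ineq1_le (x / 2); nra.
Qed.

Lemma exp_ge_cube (x : R) : 0 <= x -> x ^ 3 / 27 <= exp x.
Proof.
move=> x0; have -> : x = x / 3 + (x / 3 + x / 3) by field.
rewrite 2!exp_plus; have := exp_ineq1_le (x / 3); move: (exp _) => y; set w := x / 3 => wy.
have w0 : 0 <= w by rewrite /w; lra.
have -> : (w + (w + w)) ^ 3 / 27 = w * (w * w) by field.
apply: Rmult_le_compat; [lra|nra|lra|apply: Rmult_le_compat; lra].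
Qed.

(* [z], [lam], [d] stand for sqrt f, ln (sqrt f), Delta; [x] for exp (kappa * lam). *)
Lemma parameters_exist (eps : R) : 0 < eps ->
  exists (K : nat) (lam0 : R), [/\ (1 < K)%N, 0 < lam0 &
  forall d z D H q : R, let lam := ln z in
    0 < z -> lam0 <= lam -> 0 < d -> z ^ 2 <= d ^ 2 + 1 ->
    D <= d / z -> H <= 2 * d / z -> (1 + eps) * d / lam - 1 < q ->
  exists q0 ell : R, [/\ 0 < q0, 0 < ell, q0 + H < q,
    2 * d * (INR K * (D + 1)) <= ell * (q - q0 - H) &
    2 * ell <= q0 * exp (- (d * (INR K / (INR K - 1)) / q0))]].
Proof.
move=> eps0.
(* [K] is of order 4 / eps, which makes the loss factor K / (K - 1) at most 1 + eps / 4. *)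
have [K0 [_ K0gt]] : exists n : nat, INR n <= 4 / eps < INR n + 1.
  by apply: nat_floor; apply: Rlt_le; apply: Rdiv_lt_0_compat; lra.
pose K := K0.+2; pose k := INR K.
have kE : k = INR K0 + 2 by rewrite /k /K !S_INR; lra.
have K00 := pos_INR K0.
have k_eps : / (k - 1) <= eps / 4.
  have -> : eps / 4 = / (4 / eps) by field; lra.
  apply: Rinv_le_contravar; first by apply: Rdiv_lt_0_compat; lra.
  lra.
(* With this value 1 - kappa = (1 + eps / 4) / (1 + eps / 2), so the final exponent is at most (1 -
   kappa) lam; the spare factor [x], a power of [z], absorbs the powers of [lam]. *)
pose kappa := (eps / 4) / (1 + eps / 2).
have kappa0 : 0 < kappa by apply: Rdiv_lt_0_compat; lra.
have A1 : 0 < 64 / eps by apply: Rdiv_lt_0_compat; lra.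
have ek3 : 0 < eps * kappa ^ 3 by apply: Rmult_lt_0_compat => //; apply: pow_lt.
have A2 : 0 < 1296 * k / (eps * kappa ^ 3) by apply: Rdiv_lt_0_compat => //; lra.
(* The three summands yield [z_lam], [x_large] and [lam2] respectively. *)
exists K, (64 / eps + 1296 * k / (eps * kappa ^ 3) + 2); split=> //; first by lra.
move=> d z D H q lam z0 lam_large d0 zd Dle Hle qgt; rewrite -/k.
have lam2 : 2 <= lam by lra.
have zE : exp lam = z by rewrite exp_ln.
have z_lam : 16 * lam <= eps * z.
  have : lam ^ 2 / 4 <= z by rewrite -zE; apply: exp_ge_square; lra.
  have : 64 <= eps * lam.
    have -> : 64 = eps * (64 / eps) by field; lra.
    by apply: Rmult_le_compat_l; lra.
  nra.
have z2 : 2 <= z by have := exp_ineq1_le lam; rewrite zE; lra.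
(* The upper bound on [z ^ 2] enters here; it makes the roundings in D + 1 and in [q] affordable. *)
have zd2 : z <= 2 * d by nra.
pose x := exp (kappa * lam).
have x0 : 0 < x by exact: exp_pos.
have x_large : 48 * k * lam ^ 2 <= eps * x.
  have : (kappa * lam) ^ 3 / 27 <= x by apply: exp_ge_cube; nra.
  have : 1296 * k <= lam * (eps * kappa ^ 3).
    have -> : 1296 * k = 1296 * k / (eps * kappa ^ 3) * (eps * kappa ^ 3) by field; lra.
    by apply: Rmult_le_compat_r; lra.
  rewrite Rpow_mult_distr; move: (kappa ^ 3) => c; nra.
(* Half of the surplus eps goes into [q0]. Of the other half, the rounding of [q] ([E1]) and [H]
   ([E2]) each take at most eps / 8, which leaves the eps / 4 of [gap]. *)
pose q0 := (1 + eps / 2) * d / lam.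
pose ell := d / (2 * lam) * (x / z).
have dlam0 : 0 < d / lam by apply: Rdiv_lt_0_compat; lra.
have q0_gt0 : 0 < q0 by rewrite /q0 /Rdiv Rmult_assoc; apply: Rmult_lt_0_compat; lra.
have ell_gt0 : 0 < ell.
  by apply: Rmult_lt_0_compat; apply: Rdiv_lt_0_compat; lra.
have gap : eps / 4 * (d / lam) <= q - q0 - H.
  have E1 : 1 <= eps / 8 * (d / lam).
    apply: (Rmult_le_reg_r lam); first lra.
    have -> : eps / 8 * (d / lam) * lam = eps / 8 * d by field; lra.
    nra.
  have E2 : 2 * d / z <= eps / 8 * (d / lam).
    apply: (Rmult_le_reg_r (lam * z)); first nra.
    have -> : eps / 8 * (d / lam) * (lam * z) = d / 8 * (eps * z) by field; lra.
    have -> : 2 * d / z * (lam * z) = d / 8 * (16 * lam) by field; lra.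
    by apply: Rmult_le_compat_l; lra.
  have E3 : (1 + eps) * d / lam = q0 + eps / 2 * (d / lam) by rewrite /q0; field; lra.
  lra.
have gap0 : 0 < eps / 4 * (d / lam) by apply: Rmult_lt_0_compat; lra.
exists q0, ell; split=> //; first by lra.
  apply: (Rle_trans _ (ell * (eps / 4 * (d / lam)))); last by apply: Rmult_le_compat_l; lra.
  have D1 : D + 1 <= 3 * d / z.
    have -> : 3 * d / z = d / z + 2 * d / z by field; lra.
    suff : 1 <= 2 * d / z by lra.
    apply: (Rmult_le_reg_r z); first lra.
    have -> : 2 * d / z * z = 2 * d by field; lra.
    lra.
  apply: (Rle_trans _ (2 * d * (k * (3 * d / z)))).
    apply: Rmult_le_compat_l; first lra.
    by apply: Rmult_le_compat_l; lra.
  have -> : 2 * d * (k * (3 * d / z)) = d ^ 2 / (8 * z * lam ^ 2) * (48 * k * lam ^ 2) by field; lra.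
  have -> : ell * (eps / 4 * (d / lam)) = d ^ 2 / (8 * z * lam ^ 2) * (eps * x) by rewrite /ell; field; lra.
  apply: Rmult_le_compat_l => //; apply/Rlt_le/Rdiv_lt_0_compat; first exact: pow_lt.
  by apply: Rmult_lt_0_compat; [lra|apply: pow_lt; lra].
have -> : 2 * ell = d / lam * (x / z) by rewrite /ell; field; lra.
apply: Rmult_le_compat; [lra| by apply/Rlt_le/Rdiv_lt_0_compat| |].
  have -> : q0 = d / lam + eps / 2 * (d / lam) by rewrite /q0; field; lra.
  by have : 0 < eps / 2 * (d / lam); [apply: Rmult_lt_0_compat; lra|lra].
have -> : x / z = exp (- (lam * (1 - kappa))).
  rewrite /x -zE /Rdiv -exp_Ropp -exp_plus; congr exp; ring.
have kap1 : 1 - kappa = (1 + eps / 4) / (1 + eps / 2) by rewrite /kappa; field; lra.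
have -> : d * (k / (k - 1)) / q0 = lam * ((1 + / (k - 1)) / (1 + eps / 2)).
  by rewrite /q0; field; lra.
have le_exp a b : a <= b -> exp a <= exp b.
  by case=> [/exp_increasing|->]; lra.
apply: le_exp; apply: Ropp_le_contravar; apply: Rmult_le_compat_l; first lra.
rewrite kap1; apply: Rmult_le_compat_r; last lra.
by apply/Rlt_le/Rinv_0_lt_compat; lra.
Qed.
End Numerics.

(* Exponential inequalities over an ordered field *)
From mathcomp Require ring lra.
From mathcomp Require Import Rstruct.
Import Order.TTheory GRing.Theory Num.Theory.

(* E plays the role of exp. *)
Section Exponential.
Import mathcomp.algebra_tactics.ring mathcomp.algebra_tactics.lra.
Local Open Scope ring_scope.
Variables (R : realFieldType) (E : R -> R).
Hypothesis E_ge1D : forall x, 1 + x <= E x.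
Hypothesis ED : forall x y, E (x + y) = E x * E y.

Lemma exp0_eq1 : E 0 = 1.
Proof.
have E0 : 1 <= E 0 by rewrite -[leLHS]addr0 E_ge1D.
have := ED 0 0; rewrite addr0 -[LHS]mulr1 => /mulfI -> //.
by apply/lt0r_neq0/(lt_le_trans _ E0).
Qed.

Lemma expNK x : E (- x) * E x = 1.
Proof. by rewrite -ED addNr exp0_eq1. Qed.

Lemma exp_gt0 x : 0 < E x.
Proof.
have -> : x = x / 2 + x / 2 by field.
have := expNK (x / 2); rewrite ED; set y := E _ => yE; have : E (x / 2) != 0.
  by apply/eqP => e0; move: yE; rewrite e0 mulr0 => /eqP; rewrite eq_sym oner_eq0.
by rewrite -expr2 exprn_even_gt0 //.
Qed.

(** Invert 1 + w <= E w at w = 1 / (k - 1). This turns the probability 1 - 1 / k of missing a color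
    into an exponential. *)
Lemma expN_le_1BV k : 1 < k -> E (- (k - 1)^-1) <= 1 - k^-1.
Proof.
move=> k1; set w := (k - 1)^-1.
have w0 : 0 < w by rewrite invr_gt0 subr_gt0.
have -> : 1 - k^-1 = (1 + w)^-1.
  rewrite /w; field.
  by apply/andP; split; apply: lt0r_neq0; lra.
rewrite -[leRHS]mul1r ler_pdivlMr; last by lra.
by rewrite -[leRHS](expNK w) ler_pM2l ?exp_gt0 // E_ge1D.
Qed.

(* Jensen's inequality for exp, through the tangent at [- (M / q0)] *)
Lemma sum_expN_ge (I : finType) (Q : {set I}) (s : I -> R) (q0 M : R) :
  0 < q0 -> 0 <= M -> q0 <= #|Q|%:R -> \sum_(y in Q) s y <= M ->
  q0 * E (- (M / q0)) <= \sum_(y in Q) E (- s y).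
Proof.
move=> q0_gt0 M0 q0Q sM; set a := M / q0.
have tangent y : E (- a) * (1 + a - s y) <= E (- s y).
  have Esy : - s y = - a + (a - s y) by ring.
  by rewrite [in leRHS]Esy ED -addrA ler_pM2l ?exp_gt0 // E_ge1D.
apply: le_trans (ler_sum _ (fun y _ => tangent y)).
rewrite -mulr_sumr mulrC ler_pM2l ?exp_gt0 //.
(* The remaining claim is q0 <= (1 + a) #|Q| - sum of [s], and the sum is at most M = a q0 <= a
   #|Q|. *)
rewrite sumrB sumr_const -[_ *+ _]mulr_natl.
have a0 : 0 <= a by rewrite divr_ge0 // ltW.
have : M = a * q0 by rewrite /a divfK // gt_eqF.
have : a * q0 <= a * #|Q|%:R by rewrite ler_wpM2l.
by move: (#|Q|%:R) (\sum_(_ in _) _) sM q0Q => x y; nra.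
Qed.

(** * Colorings that avoid a given color on the good neighbors *)

Section Recoloring.
Variables (T : finType) (e : rel T) (q : nat).
Local Notation coloring := (partial_coloring T q).
Variables (X : {set coloring}) (G : {set T}) (L : T -> {set 'I_q}) (D : nat).
Hypothesis X_recolor : forall c u y,
  c \in X -> u \in G -> y \in avail e c u -> recolor c u (Some y) \in X.
Hypothesis X_own : forall c u y, c \in X -> c u = Some y -> y \in avail e c u.
Hypothesis availL : forall c u, c \in X -> u \in G -> avail e c u \subset L u.
Hypothesis cardL : forall c u,
  c \in X -> u \in G -> (#|L u| <= #|avail e c u| + D)%N.
Hypothesis largeL : forall u, u \in G -> (D.+1 < #|L u|)%N.

Definition avoiding (us : seq T) (y : 'I_q) : {set coloring} :=
  [set c in X | all (fun u => c u != Some y) us].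

(** A vertex with at least k = #|L u| - D available colors misses a color of its list with
    probability at least 1 - 1 / k >= E (- 1 / (k - 1)); the last step is why [D.+1] is
    subtracted. *)
Definition hit_weight (u : T) (y : 'I_q) : R :=
  (y \in L u)%:R / (#|L u|%:R - D.+1%:R).

(** Induction on [us]. A coloring that avoids [y] on [us] but has [y] at [u] can be recolored at [u]
    in at least #|L u| - D ways, still avoiding [y] on [us], and different choices give different
    results. So such colorings form at most a 1 / (#|L u| - D) share. *)
Lemma card_avoiding_ge us y : uniq us -> {subset us <= G} ->
  #|X|%:R * E (- \sum_(u <- us) hit_weight u y) <= #|avoiding us y|%:R.
Proof.
elim: us => [|u us IH] /=.
  move=> _ _; rewrite big_nil oppr0 exp0_eq1 mulr1 ler_nat.
  by apply/subset_leq_card/subsetP => c cX; rewrite inE cX.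
move=> /andP[uus us_uniq] usG.
have uG : u \in G by rewrite usG ?mem_head.
have {IH} := IH us_uniq (fun w wus => usG w (mem_behead (s := u :: us) wus)).
rewrite big_cons opprD ED mulrCA.
move: (#|X|%:R * _) => x xle.
pose Y := [set c in avoiding us y | c u == Some y].
have -> : #|avoiding (u :: us) y|%:R = #|avoiding us y|%:R - #|Y|%:R :> R.
  rewrite -natrB; last by apply/subset_leq_card/subsetP => c; rewrite inE => /andP[].
  congr _%:R; rewrite -cardsDS; last by apply/subsetP => c; rewrite inE => /andP[].
  apply: eq_card => c; rewrite !inE /=.
  by case: (c \in X) => //=; case: (c u == _) => //=; rewrite ?andbT ?andbF //; case: all.
have Yc c : c \in Y -> c \in X /\ c u = Some y.
  by rewrite !inE => /andP[/andP[cX _] /eqP].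
set A := #|avoiding us y|%:R in xle *.
apply: (@le_trans _ _ (E (- hit_weight u y) * A)); first by rewrite ler_pM2l ?exp_gt0.
rewrite /hit_weight; have [yL|yL] := boolP (y \in L u); last first.
  rewrite mul0r oppr0 exp0_eq1 mul1r (_ : #|Y| = 0) ?subr0 //.
  apply/eqP; rewrite cards_eq0 -subset0; apply/subsetP => c /Yc[cX cu].
  by case/negP: yL; apply: (subsetP (availL cX uG)); exact: X_own cu.
have YA : (#|Y| * (#|L u| - D) <= #|avoiding us y|)%N.
  rewrite -sum_nat_const.
  apply: (@leq_trans (\sum_(c in Y) #|avail e c u|)).
    by apply: leq_sum => c /Yc[cX _]; rewrite leq_subLR addnC; exact: cardL.
  apply: (sum_avail_le (a := Some y)) => [c /Yc[]//|c z cY zc].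
  have [cX _] := Yc _ cY; move: cY; rewrite !inE => /andP[/andP[_ /allP av] _].
  rewrite X_recolor //=; apply/allP => w wus; rewrite ffunE.
  by case: (w =P u) => [wu|_]; [rewrite -wu wus in uus|exact: av].
set k := #|L u|%:R - D%:R : R.
have k1 : 1 < k by rewrite /k ltrBrDr nat1r ltr_nat largeL.
have -> : 1%:R / (#|L u|%:R - D.+1%:R) = (k - 1)^-1 :> R.
  by rewrite mul1r /k -natr1 opprD addrA.
have Yk : #|Y|%:R * k <= A.
  rewrite /k -natrB -?natrM ?ler_nat //.
  by apply: ltnW; apply: ltn_trans (largeL uG).
apply: (@le_trans _ _ ((1 - k^-1) * A)).
  by rewrite ler_wpM2r ?ler0n // expN_le_1BV.
by rewrite mulrBl mul1r lerD2l lerN2 mulrC ler_pdivlMr // (lt_trans ltr01).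
Qed.

(** Summed over all colors, the hit weight of [u] is #|L u| / (#|L u| - D.+1), at most K / (K - 1)
    for a list of size at least K (D + 1). Jensen then applies with total weight [M]. *)
Lemma sum_avoiding_ge (Q : {set 'I_q}) (K : nat) (q0 M : R) :
  0 < q0 -> q0 <= #|Q|%:R -> (1 < K)%N ->
  (forall u, u \in G -> (K * D.+1 <= #|L u|)%N) ->
  #|G|%:R * (K%:R / (K%:R - 1)) <= M ->
  #|X|%:R * (q0 * E (- (M / q0))) <= \sum_(y in Q) #|avoiding (enum G) y|%:R.
Proof.
move=> q0_gt0 q0Q K1 KL GM.
have K0 : 0 < K%:R - 1 :> R by rewrite subr_gt0 ltr1n.
have M0 : 0 <= M by apply: le_trans GM; rewrite mulr_ge0 // divr_ge0 // ltW.
have L0 u : u \in G -> 0 < #|L u|%:R - D.+1%:R :> R.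
  by move=> uG; rewrite subr_gt0 ltr_nat largeL.
apply: (@le_trans _ _ (\sum_(y in Q) #|X|%:R * E (- \sum_(u <- enum G) hit_weight u y))); last first.
  apply: ler_sum => y _; apply: card_avoiding_ge (enum_uniq _) _ => u.
  by rewrite mem_enum.
rewrite -mulr_sumr ler_wpM2l //; apply: sum_expN_ge => //.
apply: le_trans GM; rewrite exchange_big /= big_enum /= mulr_natl -sumr_const.
apply: ler_sum => u uG.
apply: (@le_trans _ _ (\sum_y hit_weight u y)).
  rewrite [leRHS](bigID (mem Q)) /= lerDl sumr_ge0 // => y _.
  by rewrite divr_ge0 // ltW // L0.
rewrite -mulr_suml -natr_sum -big_mkcond /= sum1_card.
rewrite ler_pdivrMr ?L0 // mulrAC ler_pdivlMr //.
have : (K * D.+1)%:R <= #|L u|%:R :> R by rewrite ler_nat KL.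
by rewrite natrM mulrBr mulr1 mulrBr [_ * K%:R]mulrC lerD2l lerN2.
Qed.
End Recoloring.
End Exponential.

(** * The counting induction *)

Section Counting.
Import mathcomp.algebra_tactics.ring mathcomp.algebra_tactics.lra.
Local Open Scope ring_scope.
Variables (R : realFieldType) (E : R -> R).
Hypothesis E_ge1D : forall x, 1 + x <= E x.
Hypothesis ED : forall x y, E (x + y) = E x * E y.
Variables (T : finType) (e : rel T) (sym : symmetric e) (irr : irreflexive e).
Variables (q Delta H D K : nat) (q0 ell : R).
Hypothesis degD : forall v, (#|nbhd e v| <= Delta)%N.
Hypothesis highH : forall v,
  (#|[set u in nbhd e v | D < #|nbhd e u :&: nbhd e v|]| <= H)%N.
Hypothesis K_gt1 : (1 < K)%N.
Hypothesis q0_gt0 : 0 < q0.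
Hypothesis ell_gt0 : 0 < ell.
Hypothesis q0H : q0 + H%:R < q%:R.
Hypothesis ell_large : 2 * Delta%:R * (K * D.+1)%:R <= ell * (q%:R - q0 - H%:R).
(** Bounds the total hit weight of the good neighbors of any vertex. *)
Let M : R := Delta%:R * (K%:R / (K%:R - 1)).
Hypothesis ell_small : 2 * ell <= q0 * E (- (M / q0)).
Local Notation count S := (#|proper_on e q S|%:R : R).

Section Step.
Variables (S : {set T}) (v : T).
Let t := (K * D.+1)%N.
Local Notation good := (good_nbrs e S v D t).
Local Notation bad := (bad_nbrs e S v D t).
Local Notation class := (coloring_class e S v D t).
(** By [card_avail_class] this threshold leaves at least [q0] colors unblocked by the bad
    neighbors. *)
Let few_bad (c : partial_coloring T q) := #|bad c|%:R <= q%:R - q0.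

Lemma sum_avail_class r : few_bad r ->
  #|class r|%:R * (q0 * E (- (M / q0))) <= (\sum_(c in class r) #|avail e c v|)%:R.
Proof.
move=> rbad; have [->|[c0 c0r]] := set_0Vmem (class r).
  by rewrite cards0 mul0r ler0n.
apply: (@le_trans _ _ (\sum_(y in avail e r v) #|avoiding (class r) (enum (good r)) y|%:R)); last first.
  by rewrite -natr_sum ler_nat; exact: class_avail_ge.
have goodP u : u \in good r ->
    (#|nbhd e u :&: nbhd e v| <= D)%N /\ (t <= #|local_avail e v r u|)%N.
  by rewrite inE => /andP[_ /andP[]].
apply: (sum_avoiding_ge E_ge1D ED (L := local_avail e v r) (D := D) _ _ _ _ _ (K := K)) => //.
- by move=> c u y; exact: class_recolor.
- by move=> c u y /classP[cS _ _ _]; exact: own_color_avail cS.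
- by move=> c u /classP[_ _ <- _] _; exact: avail_sub_local.
- move=> c u /classP[_ _ <- _] /goodP[uD _].
  by apply: leq_trans (card_local_avail e v c u) _; rewrite leq_add2l.
- move=> u /goodP[_ tu]; apply: leq_trans tu.
  by rewrite /t -[X in (X < _)%N]mul1n ltn_pmul2r.
- have := card_avail_class c0r; rewrite -(ler_nat R) natrD => qle.
  by move: rbad; rewrite /few_bad; lra.
- by move=> u /goodP[].
- rewrite /M ler_wpM2r ?ler_nat //.
    by rewrite divr_ge0 // subr_ge0 ler1n ltnW.
  apply: leq_trans (degD v); apply/subset_leq_card.
  by apply: subset_trans (good_sub _ _ _ _ _ _) (subsetIl _ _).
Qed.

Hypothesis IH : forall u, u \in S -> ell * count (S :\ u) <= count S.

(** Markov's inequality. Up to [H] vertices of high local degree, a bad neighbor has a short list;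
    the expected number of these is at most Delta t / ell, which [ell_large] makes at most half of q
    - q0 - H. *)
Lemma card_many_bad :
  2 * #|[set c in proper_on e q S | ~~ few_bad c]|%:R <= count S.
Proof.
set Y := [set c in _ | _].
have gap : 0 < q%:R - q0 - H%:R by move: q0H; lra.
pose P (c : partial_coloring T q) := [set u in nbhd e v :&: S | (#|local_avail e v c u| < t)%N].
have badP c : (#|bad c| <= H + #|P c|)%N.
  apply: leq_trans (leq_add (highH v) (leqnn _)).
  apply: leq_trans (leq_card_setU _ _); apply/subset_leq_card/subsetP => u.
  rewrite /bad_nbrs inE [u \in good c]inE => /andP[ug uNS].
  move: ug; rewrite uNS /= negb_and -!ltnNge !inE; have [uN uS] := setIP uNS.
  by move: uN; rewrite inE => ->; rewrite uS /= orbC.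
have YP c : c \in Y -> q%:R - q0 - H%:R <= #|P c|%:R.
  rewrite inE => /andP[_]; rewrite /few_bad -ltNge.
  by have := badP c; rewrite -(ler_nat R) natrD; lra.
have sumP : \sum_(c in proper_on e q S) #|P c|%:R <= Delta%:R * (t%:R * count S / ell).
  under eq_bigr do rewrite -sum1_card natr_sum.
  rewrite (exchange_big_dep (mem (nbhd e v :&: S))) /=; last first.
    by move=> c u _; rewrite inE => /andP[].
  apply: (@le_trans _ _ (\sum_(u in nbhd e v :&: S) t%:R * count S / ell)); last first.
    rewrite sumr_const -[leLHS]mulr_natl ler_wpM2r ?ler_nat //.
      by rewrite divr_ge0 ?mulr_ge0 // ltW.
    by apply: leq_trans (degD v); rewrite subset_leq_card ?subsetIl.
  apply: ler_sum => u /setIP[uN uS].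
  rewrite -natr_sum sum1dep_card ler_pdivlMr // mulrC.
  (* A short local list forces few available colors, so [card_few_avail] applies; [IH] then trades
     the colorings of [S :\ u] for those of [S]. *)
  apply: (@le_trans _ _ (ell * (t * #|proper_on e q (S :\ u)|)%:R)).
    rewrite ler_pM2l // ler_nat; apply: leq_trans (card_few_avail irr _ t uS).
    apply/subset_leq_card/subsetP => c; rewrite !inE => /andP[-> /andP[_ /=]].
    by apply: leq_ltn_trans; rewrite subset_leq_card ?avail_sub_local.
  by rewrite natrM mulrCA ler_wpM2l // IH.
have YS : #|Y|%:R * (q%:R - q0 - H%:R) <= \sum_(c in proper_on e q S) #|P c|%:R.
  rewrite mulr_natl -sumr_const.
  apply: (@le_trans _ _ (\sum_(c in Y) #|P c|%:R)); first exact: ler_sum.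
  rewrite [leRHS](bigID (mem Y)) /= -[leLHS]addr0 lerD ?sumr_ge0 //.
  rewrite [leRHS](eq_bigl (mem Y)) // => c /=.
  by case: (boolP (c \in Y)); rewrite ?andbF // inE => /andP[->].
rewrite -(ler_pM2r (mulr_gt0 ell_gt0 gap)).
have := le_trans YS sumP; rewrite !mulrA ler_pdivlMr // => Yle.
have := ler_wpM2r (ler0n R #|proper_on e q S|) ell_large; rewrite -/t.
move: (#|Y|%:R : R) (count S) (t%:R : R) (Delta%:R : R) (q%:R - q0 - H%:R) Yle.
by move=> y c t' d g; nra.
Qed.

(** At least half of the colorings lie in classes with few bad neighbors, where the average number
    of available colors at [v] is at least [w], hence at least 2 ell. *)
Lemma count_step : v \notin S -> ell * count S <= count (v |: S).
Proof.
move=> vS.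
apply: (@le_trans _ _ (\sum_(c in proper_on e q S) #|avail e c v|)%:R); last first.
  by rewrite ler_nat sum_avail_proper.
rewrite (partition_big (forget_good e S v D t) xpredT) //= natr_sum.
set w := q0 * E (- (M / q0)).
have w0 : 0 < w by rewrite /w mulr_gt0 // (exp_gt0 E_ge1D ED).
apply: (@le_trans _ _ (w * \sum_(c in proper_on e q S) (few_bad c)%:R)).
  have split2 : count S = #|[set c in proper_on e q S | ~~ few_bad c]|%:R +
      \sum_(c in proper_on e q S) (few_bad c)%:R.
    rewrite -sum1_card -sum1dep_card !natr_sum.
    rewrite (bigID few_bad) /= addrC; congr (_ + _).
    by rewrite big_mkcondr /=; apply: eq_bigr => c _; case: (few_bad c).
  have := card_many_bad.
  set x := (#|[set c in _ | _]|%:R : R) in split2 *; set y := \sum_(_ in _) _ in split2 *.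
  rewrite split2 => xy.
  have : 2 * (ell * (x + y)) <= w * (x + y).
    by rewrite mulrA ler_wpM2r // addr_ge0 ?sumr_ge0 // /x ler0n.
  have : w * (x + y) <= w * (2 * y) by rewrite ler_pM2l //; lra.
  by move: (w) (ell) => w' l; nra.
rewrite (partition_big (forget_good e S v D t) xpredT) //= mulr_sumr.
apply: ler_sum => r _.
(* The bad neighbors are the same throughout a class, so a class counts entirely or not at all. *)
have -> : \sum_(c in proper_on e q S | forget_good e S v D t c == r) (few_bad c)%:R
    = #|class r|%:R * (few_bad r)%:R :> R.
  rewrite mulr_natl -sumr_const; apply: eq_big => [c|c /andP[_ /eqP <-]].
    by rewrite [RHS]inE.
  by rewrite /few_bad bad_forget.
have [rbad|_] := boolP (few_bad r); last by rewrite !mulr0 ler0n.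
rewrite mulr1 mulrC; apply: le_trans (sum_avail_class rbad) _.
rewrite ler_nat leq_eqVlt; apply/orP; left; apply/eqP.
by apply: eq_bigl => c; rewrite [LHS]inE.
Qed.
End Step.

Lemma count_gt0 (S : {set T}) : 0 < count S.
Proof.
(* Strong induction on size: [count_step] for a set needs the inequality for each of its subsets
   with one vertex removed. *)
have step n : forall (S' : {set T}) v, #|S'| = n -> v \notin S' -> ell * count S' <= count (v |: S').
  elim/ltn_ind: n => n IHn S' v Sn vS; apply: count_step vS => u uS.
  rewrite -{2}(setD1K uS); apply: (IHn #|S' :\ u|) => //; last by rewrite setD11.
  by rewrite -Sn [leqRHS](cardsD1 u) uS.
move: {2}#|S| (erefl #|S|) => n; elim: n S => [|n IHn] S Sn.
  rewrite ltr0n card_gt0; apply/set0Pn; exists [ffun _ => None].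
  move/eqP: Sn; rewrite cards_eq0 => /eqP ->; apply/proper_onP.
  by split=> [x|x w _]; rewrite !ffunE // inE.
have [v vS] : exists v, v \in S by apply/set0Pn; rewrite -card_gt0 Sn.
rewrite -(setD1K vS); apply: lt_le_trans (step _ _ _ erefl _); last by rewrite setD11.
apply/mulr_gt0/IHn => //.
by move: Sn; rewrite (cardsD1 v) vS => -[].
Qed.

Lemma counting_colorable : colorable e q.
Proof.
have := count_gt0 [set: T]; rewrite ltr0n card_gt0 => /set0Pn[c /proper_onP[dom pr]].
have color x : {y | c x = Some y}.
  by case E1: (c x) (dom x) => [y|]; [exists y|rewrite inE].
apply/existsP; exists [ffun x => sval (color x)].
apply/forallP => x; apply/forallP => w; apply/implyP => exw.
rewrite !ffunE; move: (pr x w exw); case: (color x) (color w) => [y /= ->] [z /= ->] /(_ isT).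
by apply: contraNneq => /= ->.
Qed.
End Counting.

(* The import of ssralg has given the key R to ring_scope. *)
Delimit Scope R_scope with R.

(** * Transfer to the Stdlib reals and conclusion *)

Section Reals.
Local Open Scope R_scope.

Lemma colorable_of_real_bounds (T : finType) (e : rel T) (q Delta H D K : nat) (q0 ell : R) :
  symmetric e -> irreflexive e ->
  (forall v, #|nbhd e v| <= Delta)%nat ->
  (forall v, #|[set u in nbhd e v | D < #|nbhd e u :&: nbhd e v|]| <= H)%nat ->
  (1 < K)%nat -> 0 < q0 -> 0 < ell -> q0 + INR H < INR q ->
  2 * INR Delta * (INR K * (INR D + 1)) <= ell * (INR q - q0 - INR H) ->
  2 * ell <= q0 * exp (- (INR Delta * (INR K / (INR K - 1)) / q0)) ->
  colorable e q.
Proof.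
move=> sym irr degD highH K1 /RltP q00 /RltP ell0 /RltP q0H /RleP large /RleP small.
(* The literal has to become a cast natural for [INRE] to translate it. *)
have two : 2 = INR 2 by [].
rewrite two !INRE in q0H large small.
apply: (counting_colorable (E := exp) _ _ sym irr degD highH K1 q00 ell0 q0H).
- by move=> x; apply/RleP; exact: exp_ineq1_le.
- exact: exp_plus.
- by rewrite natrM -(natr1 D); exact: large.
- exact: small.
Qed.

End Reals.

Theorem mainTheorem10 :
  forall eps : R, (0 < eps)%R ->
  exists f0 : R,
  forall (Delta : nat) (f : R),
    (0 < Delta)%N ->
    (f0 <= f)%R -> (f <= INR Delta ^ 2 + 1)%R ->
    forall (T : finType) (e : rel T) (sym : symmetric e) (irr : irreflexive e),
      maxdeg e = Delta ->
      (forall v : T, (INR (nbhd_edges e v) <= INR Delta ^ 2 / f)%R) ->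
      (INR (chi irr) <= (1 + eps) * INR Delta / ln (sqrt f))%R.
Proof.
move=> eps eps0; have [K [lam0 [K1 lam00 params]]] := parameters_exist eps0.
(* The square root of this threshold is exp lam0, which gives lam0 <= ln (sqrt f). *)
exists (exp (lam0 + lam0)) => Delta f Delta0 f_large f_le T e sym irr maxd sparse.
Local Open Scope R_scope.
set d := INR Delta in f_le sparse *; set z := sqrt f; set lam := ln z.
have d0 : 0 < d by apply/lt_0_INR/ssrnat.ltP.
have f0 : 0 < f by apply: Rlt_le_trans f_large; exact: exp_pos.
have z0 : 0 < z by exact: sqrt_lt_R0.
have zf : z ^ 2 = f by exact/pow2_sqrt/Rlt_le.
have exp_le : exp lam0 <= z.
  rewrite -(sqrt_square (exp lam0)); last exact/Rlt_le/exp_pos.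
  by rewrite -exp_plus; exact: sqrt_le_1_alt.
have lam_large : lam0 <= lam.
  rewrite -(ln_exp lam0) /lam; case: exp_le => [lt_z|->]; last exact: Rle_refl.
  exact/Rlt_le/ln_increasing/lt_z/exp_pos.
have lam_gt0 : 0 < lam by exact: Rlt_le_trans lam_large.
have dz0 : 0 < d / z by exact: Rdiv_lt_0_compat.
have two_dz0 : 0 <= 2 * d / z.
  by rewrite /Rdiv Rmult_assoc; apply/Rlt_le/Rmult_lt_0_compat/dz0/Rlt_0_2.
(* The thresholds d / z for the local degree and 2 d / z for the number of exceptions multiply to 2
   d ^ 2 / f, twice the allowed number of edges. *)
have [D [D1 D2]] := nat_floor (Rlt_le _ _ dz0).
have [H [H1 H2]] := nat_floor two_dz0.
have qreal0 : 0 <= (1 + eps) * d / lam.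
  apply: Rlt_le; apply: Rdiv_lt_0_compat => //; apply: Rmult_lt_0_compat => //.
  exact: Rplus_lt_0_compat Rlt_0_1 eps0.
have [q [q1 q2]] := nat_floor qreal0.
have [||q0 [ell [q00 ell0 q0H large small]]] :=
  params d z (INR D) (INR H) (INR q) z0 lam_large d0 _ D1 H1.
  by rewrite zf.
  by apply: (Rplus_lt_reg_r 1); rewrite Rplus_assoc Rplus_opp_l Rplus_0_r.
have col : colorable e q.
  apply: (colorable_of_real_bounds sym irr _ _ K1 q00 ell0 q0H large small) => v.
    by rewrite -maxd; apply: leq_bigmax.
  (* More than [H] exceptions would mean h > 2 d / z, while D + 1 > d / z by the choice of floors;
     the product then exceeds twice the number of edges allowed. *)
  rewrite leqNgt; apply/negP => many.
  have := card_high_degree v D sym irr; set h := #|_| in many *.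
  move/ssrnat.leP/le_INR; rewrite 2!mult_INR S_INR => hD.
  have hH : INR H + 1 <= INR h by rewrite -S_INR; apply/le_INR/ssrnat.leP.
  have edges : INR 2 * INR (nbhd_edges e v) <= 2 * d / z * (d / z).
    apply: (Rle_trans _ (2 * (d ^ 2 / f))).
      by apply: Rmult_le_compat_l (sparse v); apply: pos_INR.
    by rewrite -zf; apply: Req_le; field; apply: Rgt_not_eq.
  apply: (Rlt_irrefl (2 * d / z * (d / z))).
  apply: Rlt_le_trans (Rle_trans _ _ _ hD edges).
  apply: Rmult_le_0_lt_compat => //; first exact: Rlt_le.
  exact: Rlt_le_trans hH.
apply: Rle_trans q1; apply/le_INR/ssrnat.leP; rewrite /chi.
by case: ex_minnP => m _; apply.
Qed.
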